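(* Let $a,c\in\mathbb{R}$ with $ac\neq 0$. For every $m\in\mathbb{R}$ and every $q\in(0,1)$, the equilibrium state $e_2^m=(0,m,0)$ of the fractional system $$\begin{cases} D_t^q x^1(t) = -x^2(t)x^3(t)+a\,x^1(t),\\ D_t^q x^2(t) = x^1(t)x^3(t),\\ D_t^q x^3(t) = \tfrac13 x^1(t)x^2(t)-c\,x^3(t)\end{cases}$$ is unstable.
   Context: Superscripts on $x$ are coordinate indices. $D_t^q$ is the Caputo derivative of order $q\in(0,1)$, $D_t^q f(t)=\frac{1}{\Gamma(1-q)}\int_0^t (t-s)^{-q}f'(s)\,ds$. The system is called the special fractional-order Chen-Lee system. For a fractional system $D_t^q x=f(x)$ in $\mathbb{R}^n$ with $f$ smooth and $q\in(0,1)$, an equilibrium state is a point $x_e$ with $f(x_e)=0$. Let $\lambda_1,\dots,\lambda_n$ be the eigenvalues of the Jacobian matrix $J(x_e)=(\partial f_i/\partial x^j)(x_e)$, with $\arg\in(-\pi,\pi]$ and the convention $\arg(0)=0$. Stability terms are understood through Matignon's test: $x_e$ is asymptotically stable if and only if $|\arg(\lambda_i)|>\frac{q\pi}{2}$ for all $i$; $x_e$ is (locally) stable if and only if it is asymptotically stable or $|\arg(\lambda_i)|\ge\frac{q\pi}{2}$ for all $i$ and the eigenvalues with $|\arg(\lambda_j)|=\frac{q\pi}{2}$ have geometric multiplicity one; $x_e$ is unstable if it is not stable in this sense, in particular if $|\arg(\lambda_i)|<\frac{q\pi}{2}$ for some $i$. *)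

(* Defs.v *)
From HB Require Import structures.
From mathcomp Require Import all_boot all_order all_algebra.
From mathcomp Require Import complex ring lra.
From mathcomp Require Import all_classical all_reals all_analysis.

Set Implicit Arguments.
Unset Strict Implicit.
Unset Printing Implicit Defensive.

Import Order.TTheory GRing.Theory Num.Theory.
Import numFieldNormedType.Exports.

Local Open Scope classical_set_scope.
Local Open Scope ring_scope.

Definition Gamma (R : realType) (z : R) : R :=
  \int[@lebesgue_measure R]_(t in `]0, +oo[) (t `^ (z - 1) * expR (- t)).

Definition caputo_integrand (R : realType) (q : R) (f : R -> R) (t s : R) : R :=
  (t - s) `^ (- q) * derive1 f s.

Definition caputo (R : realType) (q : R) (f : R -> R) (t : R) : R :=
  (Gamma (1 - q))^-1 *
  \int[@lebesgue_measure R]_(s in `]0, t[) caputo_integrand q f t s.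

(* The autonomous system D_t^q x = f(x) in R^n; states are row vectors. *)
Record frac_system (R : realType) (n : nat) := FracSystem {
  frac_order : R;
  rhs : 'rV[R]_n -> 'rV[R]_n
}.

(* [derive1] and the integral are total, so the regularity that
   gives the Caputo derivative a meaning is required explicitly. *)
Definition solution (R : realType) (n : nat) (S : frac_system R n)
    (x : R -> 'rV[R]_n) : Prop :=
  forall i : 'I_n, let xi := fun t => x t 0 i in
  {within `[0, +oo[, continuous xi} /\
  (forall t, 0 < t ->
    [/\ derivable xi t 1,
        (@lebesgue_measure R).-integrable `]0, t[
          (EFin \o caputo_integrand (frac_order S) xi t)
      & caputo (frac_order S) xi t = rhs S (x t) 0 i]).

Definition equilibrium (R : realType) (n : nat) (S : frac_system R n)
    (xe : 'rV[R]_n) : Prop :=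
  rhs S xe = 0.

Lemma equilibrium_solution (R : realType) (n : nat) (S : frac_system R n)
    (xe : 'rV[R]_n) :
  equilibrium S xe <-> solution S (cst xe).
Proof.
have I0 q (i : 'I_n) (t : R) :
    caputo_integrand q (fun _ => xe 0 i) t = (fun=> 0).
  by apply/funext => s; rewrite /caputo_integrand derive1_cst mulr0.
have C0 q (i : 'I_n) (t : R) : caputo q (fun _ => xe 0 i) t = 0.
  rewrite /caputo (@eq_Rintegral _ _ _ _ _ (fun=> 0)) => [|s _].
    by rewrite Rintegral_cst//= mul0r mulr0.
  by rewrite I0.
split => [e0 i xi|sol].
  split; first by apply: continuous_subspaceT; exact: cst_continuous.
  move=> t t0; split; first exact: derivable_cst.
  - rewrite /xi /= I0.
    by apply: (@eq_integrable _ _ _ _ _ _ (cst 0%E)) => //; exact: integrable0.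
  - by rewrite C0 e0 mxE.
apply/rowP => i; have [_ /(_ 1 ltr01)[_ _]] := sol i.
by rewrite C0 mxE => <-.
Qed.

Definition jacobian_matrix (R : realType) (n : nat)
    (f : 'rV[R]_n -> 'rV[R]_n) (x : 'rV[R]_n) : 'M[R]_n :=
  \matrix_(i, j) 'D_(delta_mx 0 j) (fun y => f y 0 i) x.

(* The library's ['J f x] acts on row vectors: it is the transpose. *)
Lemma jacobian_matrixE (R : realType) (n : nat)
    (f : 'rV[R]_n -> 'rV[R]_n) (x : 'rV[R]_n) :
  differentiable f x -> jacobian_matrix f x = ('J f x)^T.
Proof.
move=> df; apply/matrixP => i j; rewrite !mxE.
have dc y : differentiable (fun v : 'rV[R]_n => v 0 i : R) y.
  exact: differentiable_coord.
rewrite deriveE; last exact: (differentiable_comp df (dc _)).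
have lin_c : linear (fun v : 'rV[R]_n => v 0 i : R).
  by move=> k u v; rewrite !mxE.
pose c : {linear 'rV[R]_n -> R} :=
  HB.pack (fun v : 'rV[R]_n => v 0 i : R)
    (GRing.isLinear.Build _ _ _ _ (fun v : 'rV[R]_n => v 0 i : R) lin_c).
rewrite (_ : (fun y => _) = c \o f)//.
rewrite diff_comp//= ?(diff_lin _ (f := c))//; last exact: coord_continuous.
Qed.

(* Eigenvalues are complex, so real matrices are embedded entrywise. *)
Definition complex_mx (R : realType) (n : nat) (A : 'M[R]_n) : 'M[R[i]]_n :=
  map_mx (real_complex R) A.

(* [eigenspace] is a space of left eigenvectors; its dimension is that of
   the space of right eigenvectors, the rank of A - lambda I being
   invariant under transposition. *)
Definition geometric_multiplicity (F : fieldType) (n : nat) (A : 'M[F]_n)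
    (lambda : F) : nat :=
  \rank (eigenspace A lambda).

Lemma normc_gt0 (R : rcfType) (z : R[i]) :
  z != 0 -> 0 < ComplexField.Normc.normc z.
Proof.
case: z => x y; rewrite eq_complex /= => xy0; rewrite sqrtr_gt0 lt_def.
rewrite addr_ge0 ?sqr_ge0// andbT paddr_eq0 ?sqr_ge0// !sqrf_eq0.
exact: xy0.
Qed.

Lemma sqr_normc (R : rcfType) (z : R[i]) :
  ComplexField.Normc.normc z ^+ 2 = complex.Re z ^+ 2 + complex.Im z ^+ 2.
Proof. by case: z => x y /=; rewrite sqr_sqrtr// addr_ge0 ?sqr_ge0. Qed.

Lemma Re_div_normc_itv (R : rcfType) (z : R[i]) : z != 0 ->
  -1 <= complex.Re z / ComplexField.Normc.normc z <= 1.
Proof.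
move=> z0; rewrite -ler_norml normrM normfV [X in _ / X]ger0_norm.
  rewrite ler_pdivrMr ?normc_gt0// mul1r -(ler_sqr (normr_ge0 _)).
    by rewrite real_normK ?num_real// sqr_normc lerDl sqr_ge0.
  by rewrite nnegrE ltW ?normc_gt0.
by rewrite ltW ?normc_gt0.
Qed.

Lemma Re_div_normc_gtN1 (R : rcfType) (z : R[i]) : complex.Im z != 0 ->
  -1 < complex.Re z / ComplexField.Normc.normc z.
Proof.
move=> y0; have z0 : z != 0 by apply: contraNneq y0 => ->.
rewrite ltr_pdivlMr ?normc_gt0// mulN1r ltrNl.
apply: le_lt_trans (ler_norm _) _; rewrite normrN.
rewrite -ltr_sqr ?nnegrE ?normr_ge0 ?(ltW (normc_gt0 z0))//.
by rewrite real_normK ?num_real// sqr_normc ltrDl lt_def sqr_ge0 sqrf_eq0 y0.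
Qed.

(* Principal argument in ]-pi, pi], with the convention carg 0 = 0. *)
Definition carg (R : realType) (z : R[i]) : R :=
  let theta := acos (complex.Re z / ComplexField.Normc.normc z) in
  if z == 0 then 0 else if 0 <= complex.Im z then theta else - theta.

Lemma carg_itv (R : realType) (z : R[i]) : - pi < carg z <= pi.
Proof.
have pi0 : (0 : R) < pi by exact: pi_gt0.
rewrite /carg; case: eqP => [_|/eqP z0]; first by rewrite oppr_lt0 pi0 ltW.
have th := Re_div_normc_itv z0.
case: (leP 0 (complex.Im z)) => Im0.
  by rewrite acos_lepi// andbT (lt_le_trans _ (acos_ge0 th))// oppr_lt0.
rewrite ltrN2 acos_ltpi ?(le_trans _ (ltW pi0)) ?oppr_le0 ?acos_ge0//.
by rewrite Re_div_normc_gtN1 ?lt_eqF//; case/andP: th.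
Qed.

Lemma carg_polar (R : realType) (z : R[i]) :
  z = real_complex R (ComplexField.Normc.normc z) *
      Complex (cos (carg z)) (sin (carg z)).
Proof.
have [->|z0] := eqVneq z 0.
  by rewrite ComplexField.Normc.normc0 rmorph0 mul0r.
have th := Re_div_normc_itv z0.
have n0 := normc_gt0 z0.
have E : Num.sqrt (1 - (complex.Re z / ComplexField.Normc.normc z) ^+ 2) =
         `|complex.Im z| / ComplexField.Normc.normc z.
  rewrite -[in RHS](gtr0_norm n0) -normfV -normrM -sqrtr_sqr.
  congr Num.sqrt; rewrite !expr_div_n sqr_normc; field.
  by rewrite -sqr_normc sqrf_eq0 gt_eqF.
rewrite /carg (negbTE z0); case: z z0 th n0 E => x y /= z0 th n0 E.
case: (leP 0 y) => y0; rewrite ?cosN ?sinN acosK ?in_itv//= sin_acos// E.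
  rewrite ger0_norm//; simpc; congr Complex; field; exact: lt0r_neq0.
rewrite ltr0_norm//; simpc; congr Complex; field; exact: lt0r_neq0.
Qed.

(* Matignon's spectral test, taken as the definition of stability: the order
   is meant to lie in ]0, 1[, the vector field to be smooth and xe to be an
   equilibrium. *)
Section Matignon.
Variables (R : realType) (n : nat) (S : frac_system R n) (xe : 'rV[R]_n).

Let J : 'M[R[i]]_n := complex_mx (jacobian_matrix (rhs S) xe).
Let threshold : R := frac_order S * pi / 2.

Definition asymptotically_stable : Prop :=
  forall lambda : R[i], eigenvalue J lambda -> `|carg lambda| > threshold.

Definition stable : Prop :=
  asymptotically_stable \/
  (forall lambda : R[i], eigenvalue J lambda ->
     `|carg lambda| >= threshold /\
     (`|carg lambda| = threshold -> geometric_multiplicity J lambda = 1%N)).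

Definition unstable : Prop := ~ stable.

End Matignon.

(* Coordinates x^1, x^2, x^3 are the entries of index 0, 1, 2. *)
Definition vec3 (R : realType) (u v w : R) : 'rV[R]_3 :=
  \row_j [:: u; v; w]`_j.

Definition chen_lee (R : realType) (q a c : R) : frac_system R 3 :=
  FracSystem q (fun x =>
    let x1 := x 0 0 in let x2 := x 0 1 in let x3 := x 0 2 in
    vec3 (- x2 * x3 + a * x1) (x1 * x3) (1 / 3 * x1 * x2 - c * x3)).

(* Main.v *)
Require Import Defs.
From mathcomp Require Import all_boot all_order all_algebra.
From mathcomp Require Import complex.
From mathcomp Require Import all_classical all_reals all_analysis.

Import Order.TTheory GRing.Theory Num.Theory.

Local Open Scope ring_scope.

(** The second component of the Chen-Lee vector field is the monomial
    [x1 * x3], which vanishes to second order on the axis [x1 = x3 = 0].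
    Its gradient therefore vanishes at every [(0, m, 0)], so the Jacobian
    has a zero row and [0] is an eigenvalue.  Since [arg 0 = 0] lies strictly
    below the positive threshold [q * pi / 2], Matignon's test fails, whatever
    the two other eigenvalues are ([zero_eigenvalue_unstable]). *)

(** The difference quotient vanishes identically, so the directional derivative
    exists and is zero without any regularity of [f] off the line. *)
Lemma derive_constant_on_line (R : realType) (V : normedModType R)
    (f : V -> R) (x v : V) :
  (forall h : R, f (h *: v + x) = f x) -> 'D_v f x = 0.
Proof.
move=> fE; rewrite /derive.
rewrite (_ : (fun h : R => _) = cst 0); first exact: lim_cst.
by apply/funext => h /=; rewrite fE subrr scaler0.
Qed.

(** A basis row vector picks out the zero row, hence is a left eigenvector. *)
Lemma zero_row_eigenvalue (F : fieldType) (n : nat) (A : 'M[F]_n) (i : 'I_n) :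
  row i A = 0 -> eigenvalue A 0.
Proof.
move=> Ai0; apply/eigenvalueP; exists (delta_mx 0 i).
  by rewrite -rowE Ai0 scale0r.
by apply/eqP => /rowP/(_ i)/eqP; rewrite !mxE !eqxx oner_eq0.
Qed.

(** With the convention [arg 0 = 0], the eigenvalue [0] violates even the
    non-strict inequality of the test, so no multiplicity can rescue it. *)
Lemma zero_eigenvalue_unstable (R : realType) (n : nat) (S : frac_system R n)
    (xe : 'rV[R]_n) :
  0 < frac_order S ->
  eigenvalue (complex_mx (jacobian_matrix (rhs S) xe)) 0 ->
  unstable S xe.
Proof.
move=> q0 J0; have th0 : 0 < frac_order S * pi / 2.
  by rewrite divr_gt0// mulr_gt0// pi_gt0.
have arg0 : `|carg (0 : R[i])| = 0 by rewrite /carg eqxx normr0.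
move=> [/(_ _ J0)|/(_ _ J0)[+ _]]; rewrite arg0.
  by rewrite ltNge ltW.
by rewrite leNgt th0.
Qed.

Lemma chen_lee_axis_equilibrium (R : realType) (q a c m : R) :
  equilibrium (chen_lee q a c) (vec3 0 m 0).
Proof.
apply/rowP => -[[|[|[|//]]] lt_i3]; rewrite !mxE /=.
- by rewrite !mulr0 addr0.
- by rewrite mulr0.
- by rewrite !mulr0 mul0r subr0.
Qed.

(** Moving from [(0, m, 0)] along one coordinate axis keeps at least one of
    [x1], [x3] equal to [0], so [x1 * x3] is constant along each axis. *)
Lemma chen_lee_axis_jacobian_row (R : realType) (q a c m : R) :
  row 1 (jacobian_matrix (rhs (chen_lee q a c)) (vec3 0 m 0)) = 0.
Proof.
apply/rowP => j; rewrite !mxE; apply: derive_constant_on_line => h.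
rewrite !mxE /=; case: j => -[|[|[|//]]] lt_j3 /=;
  by rewrite !(mulr0, mul0r, addr0).
Qed.

Theorem proposition3 (R : realType) (a c : R) (hac : a * c != 0)
    (m : R) (q : R) (hq0 : 0 < q) (hq1 : q < 1) :
  equilibrium (chen_lee q a c) (vec3 0 m 0) /\
  unstable (chen_lee q a c) (vec3 0 m 0).
Proof.
split; first exact: chen_lee_axis_equilibrium.
apply: zero_eigenvalue_unstable => //; apply: (@zero_row_eigenvalue _ _ _ 1).
by rewrite /complex_mx -map_row chen_lee_axis_jacobian_row map_mx0.
Qed.
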